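(* Let $W$ be a finite-dimensional complex vector space with $\dim W>1$. Then, except for the case $p=1$, all graded Lie algebras of polynomial type $\mathfrak p^p(W,B_0,\lambda)$ are associated to an $\mathfrak{sl}_2$-triple. That is, for every non-degenerate invariant symmetric bilinear form $B_0$ on $\mathfrak{gl}(W)$ and every $\lambda\in\mathbb C^*$, $\mathfrak p^p(W,B_0,\lambda)$ is associated to an $\mathfrak{sl}_2$-triple for every integer $p\ge2$, and it is not for $p=1$.
   Context: All vector spaces and Lie algebras are over $\mathbb C$. For a finite-dimensional Lie algebra $\mathfrak g_0$ with a non-degenerate invariant symmetric bilinear form $B_0$ and a finite-dimensional representation $(\rho,V)$, let $\Gamma(\mathfrak g_0,B_0,\rho)=V^*\oplus\mathfrak g_0\oplus V$ (degrees $-1,0,1$) be the local Lie algebra with the bracket of $\mathfrak g_0$, the anticommutative brackets $[U,X]=\rho(U)X$, $[U,Y]=\rho^*(U)Y$ ($\rho^*$ contragredient), and $[X,Y]\in\mathfrak g_0$ defined by $B_0([X,Y],U)=Y(\rho(U)X)$ for all $U\in\mathfrak g_0$ ($X\in V$, $Y\in V^*$). $\mathfrak g_{min}(\Gamma)$ denotes the minimal graded Lie algebra with local part $\Gamma$: the unique $\mathbb Z$-graded Lie algebra generated by its degree $-1,0,1$ part, this part being $\Gamma$, and having no nonzero graded ideal that meets $\Gamma$ trivially. For an integer $p\ge1$ let $\mathbb C^p[W]$ be the space of homogeneous polynomials of degree $p$ on $W$. For $\lambda\in\mathbb C^*$, $\rho_\lambda$ is the representation of $\mathfrak{gl}(W)$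 on $\mathbb C^p[W]$ whose restriction to $\mathfrak{sl}(W)$ is the natural representation (derived from $(g.P)(x)=P(g^{-1}x)$) and with $\rho_\lambda(\mathrm{Id}_W)=\lambda\,\mathrm{Id}_{\mathbb C^p[W]}$. The Lie algebra of polynomial type is $\mathfrak p^p(W,B_0,\lambda)=\mathfrak g_{min}(\Gamma(\mathfrak{gl}(W),B_0,\rho_\lambda))$. A triple $(y,h,x)$ is an $\mathfrak{sl}_2$-triple if $[h,x]=2x$, $[h,y]=-2y$, $[y,x]=h$. Let $H_0=\frac2\lambda\mathrm{Id}_W$, so $\rho_\lambda(H_0)=2\,\mathrm{Id}$. $\mathfrak p^p(W,B_0,\lambda)$ is associated to an $\mathfrak{sl}_2$-triple if there exist $X\in\mathbb C^p[W]$ and $Y\in(\mathbb C^p[W])^*$ such that $(Y,H_0,X)$ is an $\mathfrak{sl}_2$-triple. *)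

(* Defs.v *)
From HB Require Import structures.
From mathcomp Require Import all_boot all_order all_algebra.
From mathcomp Require Import classical_sets reals.
From mathcomp Require Import complex.
From mathcomp Require Import mpoly.
Set Implicit Arguments.
Unset Strict Implicit.
Unset Printing Implicit Defensive.
Import GRing.Theory.
Local Open Scope ring_scope.

HB.mixin Record Lmodule_isLie (K : fieldType) L of GRing.Lmodule K L := {
  lie : L -> L -> L;
  lie_linearl : forall y, linear (lie ^~ y);
  lie_linearr : forall x, linear (lie x);
  liexx : forall x, lie x x = 0;
  lie_jacobi : forall x y z,
    lie x (lie y z) + lie y (lie z x) + lie z (lie x y) = 0
}.

#[short(type="lieType")]
HB.structure Definition Lie (K : fieldType) :=
  {L of Lmodule_isLie K L & GRing.Lmodule K L}.

#[short(type="finLieType")]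
HB.structure Definition FinLie (K : fieldType) :=
  {L of Lmodule_isLie K L & Vector K L}.

Notation gl W := 'End(W).

Section GlLie.
Variables (K : fieldType) (W : vectType K).
Implicit Types A B C : gl W.

Definition gl_lie A B : gl W := ((A \o B) - (B \o A))%VF.

Fact gl_lie_linearl B : linear (gl_lie ^~ B).
Proof.
move=> a A A'; rewrite /gl_lie comp_lfunDl comp_lfunDr -comp_lfunZl -comp_lfunZr.
by rewrite scalerBr opprD addrACA.
Qed.

Fact gl_lie_linearr A : linear (gl_lie A).
Proof.
move=> a B B'; rewrite /gl_lie comp_lfunDl comp_lfunDr -comp_lfunZl -comp_lfunZr.
by rewrite scalerBr opprD addrACA.
Qed.

Fact gl_liexx A : gl_lie A A = 0.
Proof. exact: subrr. Qed.

Fact gl_lie_jacobi A B C :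
  gl_lie A (gl_lie B C) + gl_lie B (gl_lie C A) + gl_lie C (gl_lie A B) = 0.
Proof.
rewrite /gl_lie !(comp_lfunDl, comp_lfunDr, comp_lfunNl, comp_lfunNr).
rewrite !comp_lfunA !opprD !opprK.
set a := (A \o B \o C)%VF; set b := (A \o C \o B)%VF.
set c := (B \o C \o A)%VF; set d := (B \o A \o C)%VF.
set e := (C \o A \o B)%VF; set f := (C \o B \o A)%VF.
rewrite !addrA.
rewrite [LHS](ACl ((1*11)*(2*8)*(3*5)*(4*10)*(6*12)*(7*9)))%AC /=.
by rewrite !(subrr, addNr, addr0).
Qed.

HB.instance Definition _ := Lmodule_isLie.Build K (gl W)
  gl_lie_linearl gl_lie_linearr gl_liexx gl_lie_jacobi.
End GlLie.

Record repr (K : fieldType) (g : lieType K) (V : vectType K) := Repr {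
  repr_fun :> g -> gl V;
  repr_linear : linear repr_fun;
  repr_lie : forall x y, repr_fun (lie x y) = lie (repr_fun x) (repr_fun y)
}.


HB.instance Definition _ (K : fieldType) (g : lieType K) (V : vectType K)
    (rho : repr g V) :=
  GRing.isLinear.Build K g (gl V) *:%R rho (@repr_linear K g V rho).

(* Only the instances of the Jacobi identity all of whose brackets lie in
   degrees -1, 0, 1 are imposed. *)
Record localLie (K : fieldType) := LocalLie {
  loc0 : finLieType K;
  locp : vectType K;
  locm : vectType K;
  loc_actp : repr loc0 locp;
  loc_actm : repr loc0 locm;
  loc_pm : locp -> locm -> loc0;
  loc_pm_linearl : forall Y, linear (loc_pm ^~ Y);
  loc_pm_linearr : forall X, linear (loc_pm X);
  loc_jacobi : forall U X Y, lie U (loc_pm X Y) =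
    loc_pm (loc_actp U X) Y + loc_pm X (loc_actm U Y)
}.

(* Bilinearity follows from linearity on the right and symmetry. *)
Record invForm (K : fieldType) (g : lieType K) := InvForm {
  iform :> g -> g -> K;
  iform_linear : forall x, linear (iform x : g -> K^o);
  iformC : forall x y, iform x y = iform y x;
  iform_inv : forall x y z, iform (lie x y) z = iform x (lie y z);
  iform_nondeg : forall x, (forall y, iform x y = 0) -> x = 0
}.

Section Contragredient.
Variables (K : fieldType) (g : lieType K) (V : vectType K) (rho : repr g V).

Definition contra_act (U : g) (Y : 'Hom(V, K^o)) : 'Hom(V, K^o) :=
  - (Y \o rho U)%VF.

Fact contra_act_linear U : linear (contra_act U).
Proof.
move=> a Y Y'; rewrite /contra_act comp_lfunDl -comp_lfunZl.
by rewrite opprD scalerN.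
Qed.

HB.instance Definition _ U := GRing.isLinear.Build K _ _ *:%R (contra_act U)
  (contra_act_linear U).

Definition contra_fun (U : g) : gl 'Hom(V, K^o) := linfun (contra_act U).

Fact contra_linear : linear contra_fun.
Proof.
move=> a U U'; apply/lfunP => Y; rewrite add_lfunE scale_lfunE !lfunE /=.
rewrite /contra_act linearP comp_lfunDr -comp_lfunZr.
by rewrite opprD scalerN.
Qed.

Fact contra_lie U U' :
  contra_fun (lie U U') = lie (contra_fun U) (contra_fun U').
Proof.
apply/lfunP => Y; rewrite [RHS]add_lfunE opp_lfunE !comp_lfunE !lfunE /=.
rewrite /contra_act repr_lie /lie /= /gl_lie !(comp_lfunDr, comp_lfunNr, comp_lfunNl).
by rewrite !opprK !comp_lfunA opprD opprK addrC.
Qed.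

Definition contragredient : repr g 'Hom(V, K^o) := Repr contra_linear contra_lie.
End Contragredient.

Section Gamma.
Variables (K : fieldType) (g : finLieType K) (B : invForm g).
Variables (V : vectType K) (rho : repr g V).

HB.instance Definition _ x := GRing.isLinear.Build K g K^o *:%R (B x)
  (iform_linear B x).

Definition flat (Z : g) : 'Hom(g, K^o) := linfun (B Z : g -> K^o).

Fact flat_linear : linear flat.
Proof.
move=> a Z Z'; apply/lfunP => U; rewrite add_lfunE scale_lfunE !lfunE /=.
by rewrite iformC linearP /= !(iformC B U).
Qed.

HB.instance Definition _ := GRing.isLinear.Build K g _ *:%R flat flat_linear.

Definition sharp : 'Hom('Hom(g, K^o), g) := (linfun flat)^-1%VF.

Lemma sharpE (f : 'Hom(g, K^o)) U : B (sharp f) U = f U.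
Proof.
have ker0 : lker (linfun flat) == 0%VS.
  apply/lker0P => Z Z'; rewrite !lfunE /= => /lfunP eqZ.
  apply/eqP; rewrite -subr_eq0; apply/eqP/(@iform_nondeg _ _ B) => y.
  rewrite iformC linearB /= !(iformC B y).
  by have := eqZ y; rewrite !lfunE /= => ->; rewrite subrr.
have full : limg (linfun flat) = fullv.
  apply/eqP; rewrite eqEdim subvf /= limg_dim_eq; last first.
    by rewrite (eqP ker0) capv0.
  by rewrite !dimvf /= /dim /= muln1.
have : linfun flat (sharp f) = f by rewrite limg_lfunVK // full memvf.
by rewrite lfunE /= => /lfunP /(_ U); rewrite lfunE.
Qed.

Definition Gamma_pairing (X : V) (Y : 'Hom(V, K^o)) (U : g) : K^o :=
  Y (rho U X).

(* [X, Y] is the element representing [U |-> Y (rho U X)] through [B]; see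
   [Gamma_pmE]. *)
Definition Gamma_pm (X : V) (Y : 'Hom(V, K^o)) : g :=
  sharp (linfun (Gamma_pairing X Y)).

Fact Gamma_pairing_linear X Y : linear (Gamma_pairing X Y).
Proof.
by move=> a U U'; rewrite /Gamma_pairing linearP add_lfunE scale_lfunE linearP.
Qed.

HB.instance Definition _ X Y := GRing.isLinear.Build K g K^o *:%R
  (Gamma_pairing X Y) (Gamma_pairing_linear X Y).

Lemma Gamma_pmE X Y U : B (Gamma_pm X Y) U = Y (rho U X).
Proof. by rewrite sharpE lfunE. Qed.

Lemma iform_inj Z Z' : (forall U, B Z U = B Z' U) -> Z = Z'.
Proof.
move=> eqZ; apply/eqP; rewrite -subr_eq0; apply/eqP/(@iform_nondeg _ _ B) => U.
by rewrite iformC linearB /= !(iformC B U) eqZ subrr.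
Qed.

Fact Gamma_pm_linearl Y : linear (Gamma_pm ^~ Y).
Proof.
move=> a X X'; apply: iform_inj => U.
by rewrite [in RHS]iformC linearP /= !(iformC B U) !Gamma_pmE !linearP.
Qed.

Fact Gamma_pm_linearr X : linear (Gamma_pm X).
Proof.
move=> a Y Y'; apply: iform_inj => U.
rewrite [in RHS]iformC linearP /= !(iformC B U) !Gamma_pmE.
by rewrite add_lfunE scale_lfunE.
Qed.

Fact lieC (x y : g) : lie x y = - lie y x.
Proof.
apply/eqP; rewrite -addr_eq0.
have := liexx (x + y).
have lD z : {morph (lie z) : u v / u + v}.
  by move=> u v; have := lie_linearr z 1 u v; rewrite !scale1r.
have rD z : {morph (lie ^~ z) : u v / u + v}.
  by move=> u v; have := lie_linearl z 1 u v; rewrite !scale1r.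
by rewrite /= rD !lD !liexx add0r addr0 => ->.
Qed.

Fact Gamma_jacobi U X Y : lie U (Gamma_pm X Y) =
  Gamma_pm (rho U X) Y + Gamma_pm X (contragredient rho U Y).
Proof.
apply: iform_inj => U'.
rewrite lieC iformC linearN /= iformC iform_inv Gamma_pmE.
rewrite [in RHS]iformC linearD /= !(iformC B U') !Gamma_pmE.
rewrite lfunE /= /contra_act opp_lfunE comp_lfunE repr_lie.
rewrite [lie _ _]/(_ - _) add_lfunE opp_lfunE !comp_lfunE linearB /= opprB.
by rewrite addrC.
Qed.

Definition Gamma : localLie K :=
  LocalLie Gamma_pm_linearl Gamma_pm_linearr Gamma_jacobi.
End Gamma.

Section Subspaces.
Variables (K : fieldType) (L : lieType K).
Local Open Scope classical_set_scope.

Definition subspace (S : set L) : Prop :=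
  S 0 /\ forall (a : K) u v, S u -> S v -> S (a *: u + v).

Definition subalgebra (S : set L) : Prop :=
  subspace S /\ forall x y, S x -> S y -> S (lie x y).

Definition ideal (I : set L) : Prop :=
  subspace I /\ forall x y, I y -> I (lie x y).
End Subspaces.

Record gradedLie (K : fieldType) := GradedLie {
  graded_sort :> lieType K;
  gr : int -> set graded_sort;
  gr_subspace : forall i, subspace (gr i);
  gr_lie : forall i j x y, gr i x -> gr j y -> gr (i + j) (lie x y);
  gr_span : forall x, exists (s : seq int) (u : int -> graded_sort),
    [/\ uniq s, forall i, gr i (u i) & x = \sum_(i <- s) u i];
  gr_direct : forall (s : seq int) (u : int -> graded_sort), uniq s ->
    (forall i, gr i (u i)) -> \sum_(i <- s) u i = 0 ->
    forall i, i \in s -> u i = 0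
}.

Section Graded.
Variables (K : fieldType) (g : gradedLie K).
Local Open Scope classical_set_scope.

Definition graded_ideal (I : set g) : Prop :=
  ideal I /\ forall (s : seq int) (u : int -> g), uniq s ->
    (forall i, gr i (u i)) -> I (\sum_(i <- s) u i) ->
    forall i, i \in s -> I (u i).

Definition local_part : set g :=
  [set x | exists y z t, [/\ gr (-1) y, gr 0 z, gr 1 t & x = y + z + t]].

Definition generated_by_local_part : Prop :=
  forall S : set g, subalgebra S -> local_part `<=` S -> S = setT.

Definition transitive_grading : Prop :=
  forall I : set g, graded_ideal I -> I `&` local_part = [set 0] ->
    I = [set 0].
End Graded.

(* The models of the minimal graded Lie algebra with local part [G]; they are
   all isomorphic, by an isomorphism compatible with the embeddings of [G]. *)
Record gmin (K : fieldType) (G : localLie K) := Gmin {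
  gmin_graded :> gradedLie K;
  in0 : {linear loc0 G -> gmin_graded};
  inp : {linear locp G -> gmin_graded};
  inm : {linear locm G -> gmin_graded};
  in0_inj : injective in0;
  inp_inj : injective inp;
  inm_inj : injective inm;
  in0_range : range in0 = gr (g := gmin_graded) 0;
  inp_range : range inp = gr (g := gmin_graded) 1;
  inm_range : range inm = gr (g := gmin_graded) (-1);
  in0_lie : forall U U', in0 (lie U U') = lie (in0 U) (in0 U');
  inp_lie : forall U X, inp (loc_actp G U X) = lie (in0 U) (inp X);
  inm_lie : forall U Y, inm (loc_actm G U Y) = lie (in0 U) (inm Y);
  inpm_lie : forall X Y, in0 (loc_pm X Y) = lie (inp X) (inm Y);
  gmin_generated : generated_by_local_part gmin_graded;
  gmin_transitive : transitive_grading gmin_graded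
}.

Definition sl2_triple (K : fieldType) (L : lieType K) (y h x : L) : Prop :=
  [/\ lie h x = 2 *: x, lie h y = (- 2) *: y & lie y x = h].

(* [Y], [H], [X] are elements of the local part; the triple is taken in the
   graded Lie algebra. *)
Definition associated_to_sl2 (K : fieldType) (G : localLie K) (H : loc0 G)
    (g : gmin G) : Prop :=
  exists (X : locp G) (Y : locm G), sl2_triple (inm g Y) (in0 g H) (inp g X).

(* Polynomials on [W] are written in the coordinates of the basis
   [vbasis {:W}]; see [hpoly_eval] for the associated functions. *)
Definition hpoly (K : fieldType) (W : vectType K) (p : nat) : Type :=
  dhomog (\dim {:W}) K p.

HB.instance Definition _ (K : fieldType) (W : vectType K) p := GRing.Lmodule.on (hpoly W p).

Fact dhomog_vect (K : fieldType) n d :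
  Vector.axiom (if n is n'.+1 then 'C(d + n', d) else (d == 0)%N)
    (dhomog n K d).
Proof.
case: n => [|n]; last exact: dhomog_vecaxiom.
exists (fun q : dhomog 0 K d => const_mx (mpoly_of_dhomog q)@_0%MM).
  by move=> a q r; apply/matrixP => i j; rewrite !mxE mcoeffD mcoeffZ.
have mE (m : 'X_{1..0}) : m = 0%MM by apply/mnmP => - [].
case: d => [|d].
  have hg (c : K) : (c%:MP : {mpoly K[0]}) \is 0.-homog.
    by rewrite -[c%:MP]mulr1 mul_mpolyC rpredZ // dhomog1.
  exists (fun r : 'rV[K]_1 => DHomog (hg (r 0 0))).
    move=> q; apply/val_inj/mpolyP => m /=.
    by rewrite mcoeffC mxE (mE m) eqxx mulr1.
  move=> r; apply/matrixP => i j; rewrite mxE mcoeffC eqxx mulr1.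
  by rewrite !ord1.
exists (fun=> 0) => [q|r]; last by apply/matrixP => i [].
apply/val_inj/mpolyP => m /=; rewrite mcoeff0 (mE m).
apply/esym/(@dhomog_nemf_coeff _ _ mdeg d.+1); first exact: dhomog_is_dhomog.
by rewrite /= mdeg0.
Qed.

HB.instance Definition _ (K : fieldType) (W : vectType K) p :=
  Lmodule_hasFinDim.Build K (hpoly W p) (dhomog_vect K (\dim {:W}) p).

Section Natural.
Variables (K : fieldType) (W : vectType K) (p : nat).
Local Notation n := (\dim {:W}).
Local Notation e := (vbasis {:W}).
Implicit Types (A B : gl W) (P : hpoly W p) (x : W).

Definition hpoly_eval P x : K := (val P).@[fun i => coord e i x].

(* The linear form [x |-> coord e j (A x)]. *)
Definition row_form A (j : 'I_n) : {mpoly K[n]} :=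
  \sum_(i < n) coord e j (A e`_i) *: 'X_i.

Definition nat_poly A (q : {mpoly K[n]}) : {mpoly K[n]} :=
  - \sum_(j < n) row_form A j * q^`M(j).

Lemma row_form_homog A j : row_form A j \is 1.-homog.
Proof.
by apply: rpred_sum => i _; apply: rpredZ; rewrite dhomogX /= mdeg1.
Qed.

Lemma mderiv_homog (j : 'I_n) (q : {mpoly K[n]}) d :
  q \is d.+1.-homog -> q^`M(j) \is d.-homog.
Proof.
move=> /dhomogP hq; apply/dhomogP => m; rewrite mcoeff_msupp mcoeff_mderiv.
move=> nz; suff /hq : (m + U_(j))%MM \in msupp q.
  by rewrite /= mdegD mdeg1 addn1 => -[].
by rewrite mcoeff_msupp; apply: contraNneq nz => ->; rewrite mul0rn.
Qed.

Lemma mderiv_homog0 (j : 'I_n) (q : {mpoly K[n]}) :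
  q \is 0.-homog -> q^`M(j) = 0.
Proof.
move=> hq; apply/mpolyP => m; rewrite mcoeff_mderiv mcoeff0.
rewrite (@dhomog_nemf_coeff _ _ mdeg 0 q) ?mul0rn //.
by rewrite /= mdegD mdeg1 addn1.
Qed.

Fact nat_poly_homog A q : q \is p.-homog -> nat_poly A q \is p.-homog.
Proof.
move=> hq; rewrite rpredN; apply: rpred_sum => j _.
case: (p) hq => [/(@mderiv_homog0 j) ->|d /(@mderiv_homog j) hq].
  by rewrite mulr0 rpred0.
by rewrite -add1n; apply: dhomogM (row_form_homog A j) hq.
Qed.

Fact nat_poly_linear A : linear (nat_poly A).
Proof.
move=> a q r; rewrite /nat_poly scalerN -opprD scaler_sumr -big_split /=.
by congr (- _); apply: eq_bigr => j _; rewrite linearP mulrDr scalerAr.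
Qed.

Definition nat_act A P : hpoly W p := DHomog (nat_poly_homog A (valP P)).

Fact nat_act_linear A : linear (nat_act A).
Proof. by move=> a P Q; apply/val_inj; exact: nat_poly_linear. Qed.

HB.instance Definition _ A := GRing.isLinear.Build K _ _ *:%R (nat_act A)
  (nat_act_linear A).

Definition nat_fun A : gl (hpoly W p) := linfun (nat_act A).

Fact row_form_linear j : linear (row_form ^~ j).
Proof.
move=> a A B; rewrite /row_form scaler_sumr -big_split /=.
apply: eq_bigr => i _.
by rewrite add_lfunE scale_lfunE linearP scalerDl scalerA.
Qed.

Fact nat_fun_linear : linear nat_fun.
Proof.
move=> a A B; apply/lfunP => P; rewrite add_lfunE scale_lfunE !lfunE.
apply/val_inj => /=; rewrite /nat_poly scalerN -opprD scaler_sumr -big_split /=.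
congr (- _); apply: eq_bigr => j _.
by rewrite row_form_linear mulrDl scalerAl.
Qed.

Lemma mderiv_row_form A (j k : 'I_n) :
  (row_form A k)^`M(j) = (coord e k (A e`_j))%:MP.
Proof.
rewrite /row_form linear_sum /= (bigD1 j) //= mderivZ mderivX mnm1E eqxx.
rewrite (_ : U_(j) - U_(j) = 0)%MM; last first.
  by apply/mnmP => i; rewrite mnmBE subnn mnm0E.
rewrite mpolyX0 scale1r big1 ?addr0 => [|i ne_ij].
  by rewrite -mul_mpolyC mulr1.
by rewrite mderivZ mderivX mnm1E (negbTE ne_ij) scale0r scaler0.
Qed.

Lemma row_form_comp A B k :
  row_form (B \o A)%VF k = \sum_(j < n) row_form A j * (row_form B k)^`M(j).
Proof.
rewrite [RHS](eq_bigr (fun j : 'I_n => \sum_(i < n)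
    (coord e j (A e`_i) * coord e k (B e`_j)) *: 'X_i)); last first.
  move=> j _; rewrite mderiv_row_form mulrC mul_mpolyC scaler_sumr.
  by apply: eq_bigr => i _; rewrite scalerA mulrC.
rewrite exchange_big /=; apply: eq_bigr => i _; rewrite -scaler_suml.
congr (_ *: _); rewrite comp_lfunE {1}(coord_vbasis (memvf (A e`_i))).
by rewrite !linear_sum; apply: eq_bigr => j _; rewrite !linearZ.
Qed.

Lemma nat_poly_comp A B q : nat_poly A (nat_poly B q) =
  - nat_poly (B \o A)%VF q +
  \sum_(j < n) \sum_(k < n) row_form A j * row_form B k * q^`M(k)^`M(j).
Proof.
rewrite /nat_poly opprK.
under eq_bigr => j _ do rewrite linearN mulrN.
rewrite sumrN opprK.
under [in RHS]eq_bigr => k _ do rewrite row_form_comp mulr_suml.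
rewrite [X in X + _]exchange_big -big_split; apply: eq_bigr => j _ /=.
rewrite linear_sum mulr_sumr -big_split; apply: eq_bigr => k _ /=.
by rewrite mderivM mulrDr !mulrA.
Qed.

Lemma nat_poly_lie A B q : nat_poly (lie A B) q =
  nat_poly A (nat_poly B q) - nat_poly B (nat_poly A q).
Proof.
rewrite !nat_poly_comp [X in _ + X - _]exchange_big /=.
set S := (X in _ + X - _); set S' := (X in _ - (_ + X)).
have -> : S' = S.
  apply: eq_bigr => j _; apply: eq_bigr => k _.
  by rewrite mderiv_comm [row_form B _ * _]mulrC.
rewrite opprD opprK addrACA subrr addr0 /nat_poly opprK -sumrB -sumrN.
apply: eq_bigr => j _; rewrite -mulrBl -mulNr; congr (_ * _).
rewrite (_ : lie A B = -1 *: (B \o A)%VF + (A \o B)%VF).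
  by rewrite row_form_linear scaleN1r opprD opprK.
by rewrite scaleN1r addrC.
Qed.

Fact nat_fun_lie A B : nat_fun (lie A B) = lie (nat_fun A) (nat_fun B).
Proof.
apply/lfunP => P; rewrite [RHS]add_lfunE opp_lfunE !comp_lfunE !lfunE.
by apply/val_inj; exact: nat_poly_lie.
Qed.

(* The representation of [gl W] derived from [(g P)(x) = P (g^-1 x)], that is
   [(A P)(x) = - sum_j (A x)_j (d_j P)(x)]; see [nat_reprE]. *)
Definition nat_repr : repr (gl W) (hpoly W p) :=
  Repr nat_fun_linear nat_fun_lie.

(* Derivative of [q] along the curve [h] at [0]. *)
Lemma mmap_polyC_deriv (h : 'I_n -> {poly K}) (q : {mpoly K[n]}) :
  (mmap polyC h q)^`().[0] =
  \sum_(j < n) (mmap polyC h q^`M(j)).[0] * (h j)^`().[0].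
Proof.
pose Q (q : {mpoly K[n]}) := (mmap polyC h q)^`().[0] =
  \sum_(j < n) (mmap polyC h q^`M(j)).[0] * (h j)^`().[0].
have QM q1 q2 : Q q1 -> Q q2 -> Q (q1 * q2).
  move=> Q1 Q2; rewrite /Q rmorphM /= derivM hornerD !hornerM Q1 Q2.
  rewrite mulr_suml mulr_sumr -big_split; apply: eq_bigr => j _ /=.
  rewrite mderivM mmapD !rmorphM /= hornerD !hornerM mulrDl mulrA.
  by congr (_ + _); rewrite mulrAC.
have Q1 : Q 1.
  rewrite /Q rmorph1 /= derivC horner0 big1 // => j _.
  by rewrite mderivC mmap0 horner0 mul0r.
have QX i : Q 'X_i.
  rewrite /Q mmapX mmap1U (bigD1 i) //= mderivX mnm1E eqxx.
  rewrite (_ : U_(i) - U_(i) = 0)%MM; last first.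
    by apply/mnmP => k; rewrite mnmBE subnn mnm0E.
  rewrite mpolyX0 scale1r rmorph1 hornerC mul1r big1 ?addr0 // => j ne_ji.
  by rewrite mderivX mnm1E eq_sym (negbTE ne_ji) scale0r mmap0 horner0 mul0r.
have QXm (m : 'X_{1..n}) : Q 'X_[m].
  rewrite mpolyXE_id; apply: (big_ind Q) => // i _.
  by elim: (m i) => [|k IHk]; rewrite ?expr0 // exprS; apply: QM.
rewrite -/(Q q); elim/mpolyind: q => [|c m q _ _ IHq].
  rewrite /Q mmap0 derivC horner0 big1 // => j _.
  by rewrite mderivC mmap0 horner0 mul0r.
rewrite /Q mmapD derivD hornerD [(mmap polyC h q)^`().[0]]IHq.
rewrite mmapZ derivM derivC mul0r add0r hornerM hornerC QXm.
rewrite mulr_sumr -big_split; apply: eq_bigr => j _ /=.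
by rewrite mderivD mderivZ mmapD mmapZ hornerD hornerM hornerC mulrDl mulrA.
Qed.

(* [(A P)(x)] is the derivative at [t = 0] of [(g_t P)(x) = P (g_t^-1 x)] along
   the curve [g_t = (1 - t A)^-1], for which [g_0 = 1] and [g'_0 = A]. *)
Lemma nat_reprE A P x : exists2 q : {poly K},
  forall t, q.[t] = hpoly_eval P (x - t *: A x) &
  hpoly_eval (nat_repr A P) x = q^`().[0].
Proof.
pose h (j : 'I_n) : {poly K} := (coord e j x)%:P - coord e j (A x) *: 'X.
have hE (r : {mpoly K[n]}) t :
    (mmap polyC h r).[t] = r.@[fun i => coord e i (x - t *: A x)].
  rewrite mevalE /mmap horner_sum; apply: eq_bigr => m _.
  rewrite hornerM hornerC /mmap1 horner_prod; congr (_ * _).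
  apply: eq_bigr => i _; rewrite horner_exp /h hornerD hornerN hornerZ hornerX.
  by rewrite hornerC linearB linearZ /= mulrC.
exists (mmap polyC h (val P)) => [t|]; first exact: hE.
rewrite mmap_polyC_deriv /hpoly_eval lfunE /= /nat_poly mevalN.
rewrite (big_morph _ (mevalD _) (meval0 _)) -sumrN.
apply: eq_bigr => j _; rewrite hE mevalM scale0r subr0.
rewrite /h derivB derivC derivZ derivX sub0r hornerN hornerZ hornerC mulr1.
rewrite mulrN mulrC; congr (- (_ * _)).
rewrite /row_form (big_morph _ (mevalD _) (meval0 _)) {2}(coord_vbasis (memvf x)) !linear_sum /=.
by apply: eq_bigr => i _; rewrite mevalZ mevalXU !linearZ mulrC.
Qed.

End Natural.

Section RhoLambda.
Variables (K : fieldType) (W : vectType K).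
Implicit Types A B : gl W.

Definition gl_trace A : K :=
  \tr (passmx.mxof (vbasis {:W}) (vbasis {:W}) A).

Lemma gl_trace_linear : linear (gl_trace : gl W -> K^o).
Proof. by move=> a A B; rewrite /gl_trace passmx.mxof_linear mxtraceD mxtraceZ. Qed.

Lemma gl_trace_lie A B : gl_trace (lie A B) = 0.
Proof.
have e_basis := vbasisP {:W}; set e := vbasis _ in e_basis.
rewrite (_ : lie A B = -1 *: (B \o A)%VF + (A \o B)%VF); last first.
  by rewrite scaleN1r addrC.
rewrite gl_trace_linear /gl_trace !(passmx.mxof_comp _ _ e_basis) mxtrace_mulC.
by rewrite scaleN1r addNr.
Qed.

Lemma gl_trace1 : gl_trace \1%VF = (\dim {:W})%:R.
Proof. by rewrite /gl_trace passmx.mxof1 ?mxtrace1 // (basis_free (vbasisP _)). Qed.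

Lemma gl_lieZ1r A (a : K) : lie A (a *: \1%VF) = 0.
Proof.
apply/lfunP => x; rewrite add_lfunE opp_lfunE !comp_lfunE !scale_lfunE.
by rewrite !id_lfunE linearZ subrr zero_lfunE.
Qed.

Lemma gl_lieZ1l A (a : K) : lie (a *: \1%VF) A = 0.
Proof.
apply/lfunP => x; rewrite add_lfunE opp_lfunE !comp_lfunE !scale_lfunE.
by rewrite !id_lfunE linearZ subrr zero_lfunE.
Qed.

Lemma gl_lieD1 A B (a b : K) :
  lie (A + a *: \1%VF) (B + b *: \1%VF) = lie A B :> gl W.
Proof.
have := lie_linearl (B + b *: \1%VF : gl W) 1 A (a *: \1%VF).
have := lie_linearr A 1 B (b *: \1%VF).
have := lie_linearr (a *: \1%VF : gl W) 1 B (b *: \1%VF).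
rewrite /= !scale1r !gl_lieZ1l !gl_lieZ1r => h1 h2 h3.
by rewrite h3 h2 h1 !addr0.
Qed.
End RhoLambda.

Section PolynomialType.
Variables (K : fieldType) (W : vectType K) (p : nat) (lambda : K).
Implicit Types A B : gl W.

Definition gl_mean A : K := gl_trace A / (\dim {:W})%:R.

Definition gl_traceless A : gl W := A - gl_mean A *: \1%VF.

Definition rho_fun A : gl (hpoly W p) :=
  nat_repr W p (gl_traceless A) + (lambda * gl_mean A) *: \1%VF.

Fact gl_mean_linear : linear (gl_mean : gl W -> K^o).
Proof.
by move=> a A B; rewrite /gl_mean gl_trace_linear mulrDl /= -mulrA.
Qed.

Fact rho_linear : linear rho_fun.
Proof.
move=> a A B; rewrite /rho_fun /gl_traceless.
have -> : gl_mean (a *: A + B) = a * gl_mean A + gl_mean B.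
  exact: gl_mean_linear.
rewrite (_ : a *: A + B - _ =
  a *: (A - gl_mean A *: \1%VF) + (B - gl_mean B *: \1%VF)); last first.
  by rewrite scalerBr addrACA scalerDl opprD scalerA.
rewrite linearP scalerDr addrACA; congr (_ + _).
by rewrite mulrDr scalerDl scalerA mulrCA.
Qed.

Fact rho_lie A B : rho_fun (lie A B) = lie (rho_fun A) (rho_fun B).
Proof.
rewrite /rho_fun gl_lieD1 -repr_lie /gl_traceless -!scaleNr gl_lieD1.
by rewrite /gl_mean gl_trace_lie mul0r mulr0 oppr0 !scale0r !addr0.
Qed.

(* [gl W] is the direct sum of the traceless endomorphisms and the scalars; see
   [rho_lambda_sl] and [rho_lambda_id]. *)
Definition rho_lambda : repr (gl W) (hpoly W p) := Repr rho_linear rho_lie.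

Lemma rho_lambda_sl A : gl_trace A = 0 -> rho_lambda A = nat_repr W p A.
Proof.
move=> trA; rewrite /rho_lambda /= /rho_fun /gl_traceless /gl_mean trA mul0r.
by rewrite mulr0 !scale0r subr0 addr0.
Qed.

Lemma rho_lambda_id : (\dim {:W})%:R != 0 :> K ->
  rho_lambda \1%VF = lambda *: \1%VF.
Proof.
move=> n0; rewrite /rho_lambda /= /rho_fun /gl_traceless /gl_mean gl_trace1.
by rewrite divff // scale1r subrr mulr1 linear0 add0r.
Qed.

Definition polynomial_type (B0 : invForm (gl W)) : Type :=
  gmin (Gamma B0 rho_lambda).

Definition polynomial_associated_to_sl2 (B0 : invForm (gl W))
    (g : polynomial_type B0) : Prop :=
  associated_to_sl2 ((2 / lambda) *: \1%VF : loc0 (Gamma B0 rho_lambda)) g.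
End PolynomialType.

(* Main.v *)
Require Import Defs.
From HB Require Import structures.
From mathcomp Require Import all_boot all_order all_algebra.
From mathcomp Require Import reals complex.
From mathcomp Require Import mpoly.
Set Implicit Arguments.
Unset Strict Implicit.
Unset Printing Implicit Defensive.
Import GRing.Theory.
Local Open Scope ring_scope.
Local Open Scope complex_scope.

(** Write [n] for the dimension of [W].  For any [X] and [Y], the relations
    [[H, X] = 2 X] and [[H, Y] = - 2 Y] hold because [H = (2 / lambda) Id] acts
    by [2] on the polynomials, so only [[Y, X] = H] is at stake.  Tested against
    [B0], it reads [Y (A X) = - B0 (H, A)] for every endomorphism [A], with [A]
    acting through [rho_lambda].  By invariance, [B0 (Id, _)] vanishes on
    brackets, hence on traceless endomorphisms ([lie_invariant_traceless_eq0]),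
    and [B0 (Id, Id) <> 0] by nondegeneracy.  As [lambda <> 0], [Y] can be
    rescaled, and what remains is that some linear form [Y] kills [sl(W) X] but not [X]
    ([associated_criterion]); in other words, the algebra is associated to an
    sl2-triple exactly when some polynomial [X] is not in [sl(W) X].

    For [p >= 2], take for [X] the sum of the [x_k ^ p] and for [Y] the sum of
    the coefficients at the [x_k ^ p].  Differentiating [X] along [A] yields
    terms [x_i x_j ^ (p - 1)], which are pure powers only if [i = j], so
    [Y (A X) = - p tr A], while [Y X = n] ([sum_pow_coef_act],
    [sum_pow_coef_powsum]).

    For [p = 1] and [n > 1], [sl(W) X] contains all linear forms as soon as [X]
    is nonzero, so every [X] belongs to [sl(W) X].  In terms of [Y]: the matrix
    [a_i y_j] of the coordinates of [X] times those of [Y] is orthogonal to the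
    traceless matrices, hence scalar; being of rank at most one, it is zero when
    [n > 1], and so is its trace [Y X] ([eval_eq0_of_sl_orbit]). *)

(** * Lie brackets and invariant forms *)

Section LieAlgebra.
Variables (K : fieldType) (g : lieType K).

Lemma lie_anti (x y : g) : lie x y = - lie y x.
Proof.
apply/eqP; rewrite -addr_eq0.
have lr z u v : lie z (u + v) = lie z u + lie z v.
  by have := lie_linearr z 1 u v; rewrite !scale1r.
have ll z u v : lie (u + v) z = lie u z + lie v z.
  by have := lie_linearl z 1 u v; rewrite /= !scale1r.
by have := liexx (x + y); rewrite ll !lr !liexx add0r addr0 => ->.
Qed.

Variable B : invForm g.

Lemma iformP x a y z : B x (a *: y + z) = a * B x y + B x z.
Proof. exact: iform_linear. Qed.

Lemma iform0r x : B x 0 = 0.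
Proof. by have := iformP x (-1) 0 0; rewrite scaler0 addr0 mulN1r addNr. Qed.

Lemma iformZr x a y : B x (a *: y) = a * B x y.
Proof. by rewrite -[a *: y]addr0 iformP iform0r addr0. Qed.
End LieAlgebra.

(** * Rank-one endomorphisms and the trace *)

Section RankOne.
Variables (K : fieldType) (W : vectType K).
Local Notation n := (\dim {:W}).
Local Notation e := (vbasis {:W}).
Implicit Types (A B : gl W) (v w : W) (i j : 'I_n).

Lemma coord_basis i j : coord e j e`_i = (i == j)%:R.
Proof. by rewrite coord_free ?(basis_free (vbasisP _)) // eq_sym. Qed.

Definition rank1_fun v j w : W := coord e j w *: v.

Fact rank1_fun_linear v j : linear (rank1_fun v j).
Proof. by move=> a w w'; rewrite /rank1_fun linearP scalerDl scalerA. Qed.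

HB.instance Definition _ v j := GRing.isLinear.Build K W W *:%R
  (rank1_fun v j) (rank1_fun_linear v j).

Definition rank1 v j : gl W := linfun (rank1_fun v j).

Lemma rank1E v j w : rank1 v j w = coord e j w *: v.
Proof. by rewrite lfunE. Qed.

Lemma comp_rank1 A v j : (A \o rank1 v j)%VF = rank1 (A v) j.
Proof. by apply/lfunP => w; rewrite comp_lfunE !rank1E linearZ. Qed.

Lemma rank1_decomp A : A = \sum_(j < n) rank1 (A e`_j) j.
Proof.
apply/lfunP => w; rewrite sum_lfunE {1}(coord_vbasis (memvf w)) linear_sum.
by apply: eq_bigr => j _; rewrite rank1E linearZ.
Qed.

Lemma gl_traceE A : gl_trace A = \sum_(j < n) coord e j (A e`_j).
Proof.
apply: eq_bigr => j _; rewrite !mxE /= /passmx.vecof.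
congr (coord _ _ (A _)); rewrite (bigD1 j) //= mxE !eqxx scale1r.
by rewrite big1 ?addr0 // => i ne_ij; rewrite mxE eqxx (negbTE ne_ij) scale0r.
Qed.

Lemma gl_trace_rank1 v j : gl_trace (rank1 v j) = coord e j v.
Proof.
rewrite gl_traceE (bigD1 j) //= rank1E coord_basis eqxx scale1r.
rewrite big1 ?addr0 // => i ne_ij.
by rewrite rank1E coord_basis (negbTE ne_ij) scale0r linear0.
Qed.

(** Such a form is a multiple of the trace.  Every endomorphism is a sum of
    rank-one ones, and [f (B \o C) = f (C \o B)]; exchanging the factors of
    [rank1 v j = rank1 v o \o rank1 e_o j], for a fixed index [o], turns it into
    [coord e j v] times [rank1 e_o o]. *)
Lemma lie_invariant_traceless_eq0 (f : {linear gl W -> K^o}) :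
  (forall A B, f (lie A B) = 0) -> forall A, gl_trace A = 0 -> f A = 0.
Proof.
move=> f_lie A trA.
have fC B C : f (B \o C)%VF = f (C \o B)%VF.
  by apply/eqP; rewrite -subr_eq0 -linearB f_lie.
have [n0|n_gt0] := posnP n.
  rewrite [A]rank1_decomp big1 ?linear0 // => j _.
  by case/negP: (negbT (ltn0 j)); rewrite -[X in (_ < X)%N]n0.
pose o : 'I_n := Ordinal n_gt0.
have fr v j : f (rank1 v j) = coord e j v * f (rank1 e`_o o).
  have -> : rank1 v j = (rank1 v o \o rank1 e`_o j)%VF.
    by rewrite comp_rank1 rank1E coord_basis eqxx scale1r.
  rewrite fC comp_rank1 rank1E.
  rewrite (_ : rank1 _ o = coord e j v *: rank1 e`_o o) ?linearZ //.
  by apply/lfunP => w; rewrite scale_lfunE !rank1E scalerA mulrC -scalerA.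
rewrite [A]rank1_decomp linear_sum.
under eq_bigr do rewrite fr.
by rewrite -mulr_suml -gl_traceE trA mul0r.
Qed.

Lemma iform1_traceless (B0 : invForm (gl W)) A :
  gl_trace A = 0 -> B0 (\1%VF : gl W) A = 0.
Proof.
move=> trA; pose f : {linear gl W -> K^o} := B0 (\1%VF : gl W).
apply: (lie_invariant_traceless_eq0 (f := f)) trA => A1 A2.
have lie1 : lie (\1%VF : gl W) A1 = 0 by rewrite -[\1%VF]scale1r gl_lieZ1l.
by rewrite /f /= -iform_inv lie1 iformC iform0r.
Qed.
End RankOne.

(** * Reduction to the natural action of traceless endomorphisms *)

Section Criterion.
Variables (K : fieldType) (W : vectType K) (p : nat) (lambda : K).
Local Notation n := (\dim {:W}).
Variable B0 : invForm (gl W).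
Hypotheses (n_neq0 : n%:R != 0 :> K) (lambda_neq0 : lambda != 0).

Lemma traceless_decomp (A : gl W) : A = gl_traceless A + gl_mean A *: \1%VF.
Proof. by rewrite /gl_traceless subrK. Qed.

Lemma gl_trace_traceless (A : gl W) : gl_trace (gl_traceless A) = 0.
Proof.
rewrite /gl_traceless addrC -scaleNr gl_trace_linear gl_trace1.
by rewrite -[_ *: _]/(_ * _) mulNr /gl_mean divfK // addNr.
Qed.

Lemma iform1E (A : gl W) :
  B0 (\1%VF : gl W) A = gl_mean A * B0 (\1%VF : gl W) (\1%VF : gl W).
Proof.
rewrite {1}[A]traceless_decomp addrC iformP.
rewrite (@iform1_traceless _ _ _ (gl_traceless A)) ?addr0 //.
exact: gl_trace_traceless.
Qed.

Lemma iform11_neq0 : B0 (\1%VF : gl W) (\1%VF : gl W) != 0.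
Proof.
apply/negP => /eqP B11; have : (\1%VF : gl W) = 0.
  by apply: (@iform_nondeg _ _ B0) => A; rewrite iform1E B11 mulr0.
move=> /(congr1 (@gl_trace K W)); rewrite gl_trace1 gl_traceE big1.
  by move/eqP; rewrite (negbTE n_neq0).
by move=> j _; rewrite zero_lfunE linear0.
Qed.

(** Both sides of the equation are determined by pairing with all endomorphisms,
    which split into traceless ones, orthogonal to the identity, and scalars. *)
Lemma Gamma_pm_eq_id (X : hpoly W p) (Y : 'Hom(hpoly W p, K^o)) (c : K) :
  Gamma_pm B0 (rho_lambda W p lambda) X Y = c *: \1%VF <->
  (forall A, gl_trace A = 0 -> Y (nat_repr W p A X) = 0) /\
  lambda * Y X = c * B0 (\1%VF : gl W) (\1%VF : gl W).
Proof.
have B1Z (A : gl W) : B0 (c *: \1%VF : gl W) A = c * B0 (\1%VF : gl W) A.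
  by rewrite iformC iformZr iformC.
split=> [eqXY|[Ysl YX]].
  split=> [A trA|].
    rewrite -(rho_lambda_sl p lambda trA) -(Gamma_pmE B0) eqXY B1Z.
    by rewrite iform1_traceless ?mulr0.
  rewrite -B1Z -eqXY Gamma_pmE rho_lambda_id // scale_lfunE id_lfunE.
  by rewrite linearZ.
apply: (iform_inj (B := B0)) => A; rewrite Gamma_pmE B1Z iform1E.
rewrite /= /rho_fun add_lfunE linearD /= Ysl ?gl_trace_traceless // add0r.
rewrite scale_lfunE id_lfunE linearZ -[LHS]/(_ * _).
by rewrite mulrAC YX [RHS]mulrCA mulrC.
Qed.

(** The first two relations of the triple are automatic, and the third is
    [Gamma_pm_eq_id].  The nonzero scalar it prescribes for [Y X] can be
    reached by rescaling [Y], since the condition on traceless endomorphisms is linear. *)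
Lemma associated_criterion (g : polynomial_type p lambda B0) :
  (2 : K) != 0 ->
  polynomial_associated_to_sl2 g <->
  exists (X : hpoly W p) (Y : 'Hom(hpoly W p, K^o)),
    Y X != 0 /\ forall A, gl_trace A = 0 -> Y (nat_repr W p A X) = 0.
Proof.
move=> two_neq0.
pose H : gl W := (2 / lambda) *: \1%VF.
have rhoH X : rho_lambda W p lambda H X = 2 *: X.
  have -> : rho_lambda W p lambda H =
      (2 / lambda) *: rho_lambda W p lambda \1%VF by exact: linearZ.
  by rewrite rho_lambda_id // scalerA divfK // scale_lfunE id_lfunE.
have tripleP X Y : lie (inm g Y) (inp g X) = in0 g H <->
    Gamma_pm B0 (rho_lambda W p lambda) X Y = - (2 / lambda) *: \1%VF.
  rewrite lie_anti -inpm_lie -linearN /= scaleNr -/H; split=> [/in0_inj <-|->].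
    by rewrite opprK.
  by rewrite opprK.
split=> [[X [Y [_ _ /tripleP/Gamma_pm_eq_id[Ysl YX]]]]|[X [Y [YX Ysl]]]].
  exists X, Y; split=> //; apply: contraTneq isT => YX0.
  have /eqP := YX; rewrite YX0 mulr0 eq_sym !mulf_eq0 oppr_eq0 mulf_eq0.
  rewrite invr_eq0 (negbTE lambda_neq0) (negbTE two_neq0).
  by rewrite (negbTE iform11_neq0).
(* The factor that gives [lambda * Y X] the value prescribed by
   [Gamma_pm_eq_id] for the scalar [- (2 / lambda)]. *)
pose c := - (2 / lambda) * B0 (\1%VF : gl W) (\1%VF : gl W) / (lambda * Y X).
exists X, (c *: Y); split.
- by rewrite -(inp_lie g) /= -/H rhoH linearZ.
- rewrite -(inm_lie g) -linearZ /=; congr (inm g _).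
  apply/lfunP => Z; rewrite lfunE /= /contra_act.
  by rewrite opp_lfunE comp_lfunE -/H rhoH [in RHS]scale_lfunE linearZ scaleNr.
- apply/(tripleP X (c *: Y))/Gamma_pm_eq_id; split=> [A trA|].
    by rewrite scale_lfunE Ysl ?scaler0.
  rewrite scale_lfunE [_ *: _]mulrC mulrA /c mulrC divfK //.
  by rewrite mulf_neq0.
Qed.
End Criterion.

(** * Degree at least two: sums of powers *)

Section PowerSum.
Variables (K : fieldType) (W : vectType K) (d : nat).
Local Notation n := (\dim {:W}).
Local Notation e := (vbasis {:W}).
Implicit Types (A : gl W) (P : hpoly W d.+2).

Let Upow (j : 'I_n) : 'X_{1..n} := (U_(j) *+ d.+2)%MM.

Fact powsum_homog : (\sum_(j < n) 'X_[Upow j] : {mpoly K[n]}) \is d.+2.-homog.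
Proof. by apply: rpred_sum => j _; rewrite dhomogX /= mdegMn mdeg1 mul1n. Qed.

Definition powsum : hpoly W d.+2 := DHomog powsum_homog.

Definition sum_pow_coef P : K^o := \sum_(j < n) (val P)@_(Upow j).

Fact sum_pow_coef_linear : linear sum_pow_coef.
Proof.
move=> a P Q; rewrite scaler_sumr -big_split; apply: eq_bigr => j _ /=.
by rewrite mcoeffD mcoeffZ.
Qed.

HB.instance Definition _ := GRing.isLinear.Build K (hpoly W d.+2) K^o *:%R
  sum_pow_coef sum_pow_coef_linear.

(** This is where a degree at least two is used: in degree one, the term
    [U_(j) *+ d.+1] would become zero and leave [j] unconstrained. *)
Lemma eq_mnmUpow i j k :
  (U_(i) + U_(j) *+ d.+1 == Upow k)%MM = (i == k) && (j == k).
Proof.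
apply/eqP/andP => [/mnmP eqm|[/eqP -> /eqP ->]]; last by rewrite -mulmS.
have := eqm j; rewrite mnmDE !mulmnE !mnm1E eqxx mul1n eq_sym.
have [->|_] := eqVneq k j; last by rewrite addnS.
by case: eqVneq => // _; rewrite mul1n add0n => /n_Sn.
Qed.

Lemma sum_pow_coef_powsum : sum_pow_coef powsum = n%:R.
Proof.
rewrite /sum_pow_coef /= -[n in RHS]card_ord -sumr_const; apply: eq_bigr => j _.
rewrite raddf_sum (bigD1 j) //= mcoeffX eqxx big1 ?addr0 // => i ne_ij.
by rewrite mcoeffX /Upow mulmS eq_mnmUpow (negbTE ne_ij).
Qed.

Lemma nat_poly_powsum A : nat_poly A (val powsum) =
  - (\sum_(j < n) \sum_(i < n)
      (coord e j (A e`_i) * d.+2%:R) *: 'X_[U_(i) + U_(j) *+ d.+1]).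
Proof.
congr (- _); apply: eq_bigr => j _.
rewrite raddf_sum (bigD1 j) //= big1 ?addr0 => [|k ne_kj]; last first.
  by rewrite mderivX mulmnE mnm1E (negbTE ne_kj) mul0n scale0r.
rewrite mderivX mulmnE mnm1E eqxx mul1n /row_form mulr_suml.
apply: eq_bigr => i _; rewrite -scalerAl -scalerAr scalerA mpolyXD.
by congr (_ *: (_ * 'X_[_])); rewrite /Upow mulmS addmC addmK.
Qed.

Lemma sum_pow_coef_act A :
  sum_pow_coef (nat_repr W d.+2 A powsum) = - (d.+2%:R * gl_trace A).
Proof.
rewrite lfunE /sum_pow_coef /= nat_poly_powsum gl_traceE mulr_sumr.
under eq_bigr do rewrite mcoeffN.
rewrite sumrN; congr (- _); apply: eq_bigr => k _; rewrite raddf_sum.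
rewrite (bigD1 k) //= raddf_sum (bigD1 k) //=.
rewrite mcoeffZ mcoeffX eq_mnmUpow eqxx mulr1.
rewrite !big1 ?addr0 1?mulrC // => [j ne_jk|i ne_ik].
  rewrite raddf_sum big1 // => i _.
  by rewrite /= mcoeffZ mcoeffX eq_mnmUpow (negbTE ne_jk) andbF mulr0.
by rewrite mcoeffZ mcoeffX eq_mnmUpow (negbTE ne_ik) mulr0.
Qed.
End PowerSum.

(** * Degree one: linear forms *)

Section LinearForms.
Variables (K : fieldType) (W : vectType K).
Local Notation n := (\dim {:W}).
Local Notation e := (vbasis {:W}).
Implicit Types (A : gl W) (X : hpoly W 1) (i j k : 'I_n).

Fact linvar_homog i : ('X_i : {mpoly K[n]}) \is 1.-homog.
Proof. by rewrite dhomogX /= mdeg1. Qed.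

Definition linvar i : hpoly W 1 := DHomog (linvar_homog i).

Lemma mderiv_linear X j : (val X)^`M(j) = ((val X)@_U_(j))%:MP.
Proof.
have /(mderiv_homog j) := valP X; move: (_^`M(j)) (mcoeff_mderiv j (val X)).
move=> q qE /dhomogP q0; apply/mpolyP => m; rewrite mcoeffC.
have [->|m_neq0] := eqVneq m 0%MM; first by rewrite qE mnm0E add0m mulr1.
rewrite mulr0; apply: memN_msupp_eq0; apply/negP => /q0 /eqP.
by rewrite /= mdeg_eq0 (negbTE m_neq0).
Qed.

Lemma linform_decomp X : X = \sum_(j < n) (val X)@_U_(j) *: linvar j.
Proof.
apply/val_inj/mpolyP => m.
rewrite (raddf_sum (@mpoly_of_dhomog n K 1)) raddf_sum /=.
under eq_bigr do rewrite mcoeffZ mcoeffX.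
have [/mdeg1P[i /eqP->]|deg_m] := boolP (mdeg m == 1%N).
  rewrite (bigD1 i) //= eqxx mulr1 big1 ?addr0 // => j ne_ji.
  by rewrite eq_mnm1 (negbTE ne_ji) mulr0.
rewrite (dhomog_nemf_coeff (valP X)) // big1 // => j _.
case: eqP => [eq_m|_]; last by rewrite mulr0.
by rewrite -eq_m mdeg1 eqxx in deg_m.
Qed.

Lemma nat_act_linear_form X (v : W) j :
  nat_repr W 1 (rank1 v j) X =
  - (\sum_(k < n) (val X)@_U_(k) * coord e k v) *: linvar j.
Proof.
apply/val_inj; rewrite lfunE /= /nat_poly scaleNr; congr (- _).
rewrite scaler_suml; apply: eq_bigr => k _.
rewrite mderiv_linear mulrC mul_mpolyC -scalerA; congr (_ *: _).
rewrite /row_form (bigD1 j) //= rank1E coord_basis eqxx scale1r big1 ?addr0 //.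
move=> i ne_ij.
by rewrite rank1E coord_basis (negbTE ne_ij) scale0r linear0 scale0r.
Qed.

(** With [a_i] the coordinates of [X] and [y_j] the values of [Y] on the
    variables, applying [Y] to the images of [X] under the traceless
    [rank1 e_i j], for [i <> j], and [rank1 e_i i - rank1 e_j j] gives
    [a_i y_j = 0] and [a_i y_i = a_j y_j].  Then
    [(a_i y_i) ^ 2 = (a_i y_j) (a_j y_i) = 0], so each term of
    [Y X = \sum_i a_i y_i] vanishes. *)
Lemma eval_eq0_of_sl_orbit X (Y : 'Hom(hpoly W 1, K^o)) : (1 < n)%N ->
  (forall A, gl_trace A = 0 -> Y (nat_repr W 1 A X) = 0) -> Y X = 0.
Proof.
move=> n_gt1 Ysl; pose a k := (val X)@_U_(k).
have YE i j : Y (nat_repr W 1 (rank1 e`_i j) X) = - (a i * Y (linvar j)).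
  rewrite nat_act_linear_form linearZ (bigD1 i) //= coord_basis eqxx mulr1.
  rewrite big1 ?addr0 -?mulNr // => k ne_ki.
  by rewrite coord_basis eq_sym (negbTE ne_ki) mulr0.
have off_diag i j : i != j -> a i * Y (linvar j) = 0.
  move=> ne_ij; apply/eqP; rewrite -oppr_eq0 -YE Ysl //.
  by rewrite gl_trace_rank1 coord_basis (negbTE ne_ij).
have diag i j : a i * Y (linvar i) = a j * Y (linvar j).
  have /eqP : Y (nat_repr W 1 (rank1 e`_i i - rank1 e`_j j) X) = 0.
    apply: Ysl; rewrite addrC -scaleN1r gl_trace_linear !gl_trace_rank1.
    by rewrite !coord_basis !eqxx scaleN1r addNr.
  rewrite linearB add_lfunE opp_lfunE linearB /= !YE opprK addrC subr_eq0.
  by move/eqP.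
have diag0 k : a k * Y (linvar k) = 0.
  have [l ne_lk] : exists l, l != k.
    have [->|] := eqVneq k (Ordinal (ltnW n_gt1)).
      by exists (Ordinal n_gt1).
    by rewrite eq_sym; exists (Ordinal (ltnW n_gt1)).
  apply/eqP; rewrite -[_ == 0]orbb -mulf_eq0 {2}(diag k l) mulrACA.
  by rewrite [Y _ * _]mulrC mulrACA (off_diag k l) ?mul0r // eq_sym.
rewrite [X]linform_decomp linear_sum big1 // => k _; rewrite linearZ.
exact: diag0.
Qed.
End LinearForms.

Theorem theorem5p1p4 (R : realType) (W : vectType R[i])
    (dimW : (1 < \dim {:W})%N) (p : nat) (p_ge1 : (1 <= p)%N)
    (B0 : invForm (gl W)) (lambda : R[i]) (lambda_neq0 : lambda != 0)
    (g : polynomial_type p lambda B0) :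
  ((2 <= p)%N -> polynomial_associated_to_sl2 g) /\
  (p = 1%N -> ~ polynomial_associated_to_sl2 g).
Proof.
have natC_neq0 k : (0 < k)%N -> k%:R != 0 :> R[i].
  by rewrite Num.Theory.pnatr_eq0 lt0n.
have dim_neq0 := natC_neq0 _ (ltnW dimW).
have crit := associated_criterion dim_neq0 lambda_neq0 g (natC_neq0 2%N isT).
split=> [p_ge2|p1 /crit[X [Y [YX Ysl]]]].
  apply/crit; case: p p_ge2 {p_ge1 g crit} => [|[|d]] // _.
  exists (powsum W d), (linfun (@sum_pow_coef _ W d)); rewrite lfunE.
  split=> [|A trA]; first by rewrite /= sum_pow_coef_powsum.
  by rewrite lfunE /= sum_pow_coef_act trA mulr0 oppr0.
subst p; case/eqP: YX.
exact: eval_eq0_of_sl_orbit dimW Ysl.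
Qed.
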